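(* Let $D$ be any digraph of order $n$. Then $\gamma_{so}(D)=n$ if and only if for every vertex $u$ of $D$, $d^+(u)=0$ or $d^-(u)=0$.
   Context: Digraphs $D=(V,A)$ are finite, without loops or multiple arcs (pairs of opposite arcs allowed). $N^+(v)=\{w: vw\in A\}$, $N^-(v)=\{w: wv\in A\}$, $d^\pm(v)=|N^\pm(v)|$. $S\subseteq V$ is out-dominating if every $v\in V\setminus S$ has an in-neighbor in $S$. $S$ is a secure out-dominating set (SODS) if $S$ is out-dominating and for every $v\in V\setminus S$ there is $u\in(N^+(v)\cup N^-(v))\cap S$ such that $(S\setminus\{u\})\cup\{v\}$ is out-dominating; $\gamma_{so}(D)$ is the minimum size of an SODS. *)

(* Defs.v *)
From mathcomp Require Import all_boot.

Set Implicit Arguments.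
Unset Strict Implicit.
Unset Printing Implicit Defensive.

(* A finite digraph without multiple arcs is a relation [e] on a finite type,
   [e u v] meaning that uv is an arc; absence of loops is [irreflexive e]. *)

Definition out_nbh (T : finType) (e : rel T) (v : T) : {set T} :=
  [set w | e v w].

Definition in_nbh (T : finType) (e : rel T) (v : T) : {set T} :=
  [set w | e w v].

Definition out_deg (T : finType) (e : rel T) (v : T) : nat := #|out_nbh e v|.

Definition in_deg (T : finType) (e : rel T) (v : T) : nat := #|in_nbh e v|.

Definition out_dominating (T : finType) (e : rel T) (S : {set T}) : bool :=
  [forall v in ~: S, exists u in S, u \in in_nbh e v].

Definition sods (T : finType) (e : rel T) (S : {set T}) : bool :=
  out_dominating e S &&
  [forall v in ~: S,
     exists u in (out_nbh e v :|: in_nbh e v) :&: S,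
       out_dominating e ((S :\ u) :|: [set v])].

(* The whole vertex set is always an SODS (next lemma), so this is a genuine
   minimum and the default value of [arg min] plays no role. *)
Definition gamma_so (T : finType) (e : rel T) : nat :=
  #|[arg min_(S < [set: T] | sods e S) #|S|]|.

Lemma sods_setT (T : finType) (e : rel T) : sods e [set: T].
Proof. by apply/andP; split; apply/forallP => v; rewrite !inE. Qed.

Lemma gamma_soP (T : finType) (e : rel T) :
  (exists2 S, sods e S & #|S| = gamma_so e) /\
  (forall S, sods e S -> gamma_so e <= #|S|).
Proof.
rewrite /gamma_so; case: arg_minnP => [|S hS minS]; first exact: sods_setT.
by split; [exists S | exact: minS].
Qed.

(* Main.v *)
(* If [w -> u -> x], then [V \ {u}] is an SODS: [w] dominates [u], and [x] can be
   exchanged for [u], which dominates it.  Conversely, suppose every vertex is a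
   source or a sink.  A vertex [v] outside an SODS has an in-neighbor, hence is a
   sink, so it can only be exchanged with an in-neighbor; but that in-neighbor is
   a source, which nothing dominates once it is removed. *)
Require Import Defs.
From mathcomp Require Import all_boot.

Lemma out_dominatingP (T : finType) (e : rel T) (S : {set T}) :
  reflect (forall v, v \notin S -> exists2 u, u \in S & e u v)
          (out_dominating e S).
Proof.
apply: (iffP forall_inP) => domS v vS.
  have vCS : v \in ~: S by rewrite inE.
  by have /exists_inP[u uS] := domS v vCS; rewrite inE; exists u.
rewrite inE in vS; have [u uS euv] := domS v vS.
by apply/exists_inP; exists u; rewrite ?inE.
Qed.

(** Only [u] needs an in-neighbor, and [w] remains in the set because there are no loops. *)
Lemma out_dominating_setC1 (T : finType) (e : rel T) (w u : T) :
  irreflexive e -> e w u -> out_dominating e [set~ u].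
Proof.
move=> e_irr ewu; apply/out_dominatingP => v; rewrite !inE negbK => /eqP->.
by exists w => //; rewrite !inE; apply: contraTneq ewu => ->; rewrite e_irr.
Qed.

Lemma sods_setC1 (T : finType) (e : rel T) (w u x : T) :
  irreflexive e -> e w u -> e u x -> sods e [set~ u].
Proof.
move=> e_irr ewu eux; apply/andP; split; first exact: out_dominating_setC1 ewu.
have xNu : x != u by apply: contraTneq eux => ->; rewrite e_irr.
apply/forall_inP => v; rewrite !inE negbK => /eqP->.
apply/exists_inP; exists x; first by rewrite !inE eux xNu.
(* The exchange leaves out only [x], which the arc from [u] dominates. *)
suff -> : ([set~ u] :\ x) :|: [set u] = [set~ x].
  exact: out_dominating_setC1 eux.
apply/setP => y; rewrite !inE; have [->|] := eqVneq y u; last by rewrite andbT orbF.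
by rewrite orbT eq_sym xNu.
Qed.

Lemma sods_full (T : finType) (e : rel T) (S : {set T}) :
  (forall u, out_deg e u = 0 \/ in_deg e u = 0) -> sods e S -> S = [set: T].
Proof.
move=> deg0 /andP[/out_dominatingP domS /forall_inP secS].
have through w u x : e w u -> e u x -> False.
  by move=> ewu eux; case: (deg0 u) => /cards0_eq/setP;
    [move/(_ x) | move/(_ w)]; rewrite !inE ?ewu ?eux.
apply/eqP; rewrite -subTset; apply/subsetP => v _; apply: contraT => vS.
have [w _ ewv] := domS v vS.
have vCS : v \in ~: S by rewrite inE.
have /exists_inP[u] := secS v vCS.
(* An exchange along [v -> u] would give the path [w -> v -> u]. *)
rewrite !inE => /andP[/orP[evu|euv] uS]; first by case: (through w v u).
have uNv : u != v by apply: contraNneq vS => <-.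
(* After the exchange [u] is outside the set, so some [y] dominates it, giving [y -> u -> v]. *)
by move=> /out_dominatingP/(_ u)[|y _ eyu]; [rewrite !inE eqxx | case: (through y u v)].
Qed.

Theorem theorem4p5 (T : finType) (e : rel T) (n : nat)
    (e_irr : irreflexive e) (order_n : #|T| = n) :
  gamma_so e = n <-> (forall u : T, out_deg e u = 0 \/ in_deg e u = 0).
Proof.
have [[S sodsS cardS] min_gamma] := gamma_soP e.
split=> [gamma_n u | deg0]; last first.
  by rewrite -cardS (sods_full _ _ _ deg0 sodsS) cardsT.
have [out0|/set0Pn[x]] := eqVneq (out_nbh e u) set0.
  by left; rewrite /out_deg out0 cards0.
have [in0|/set0Pn[w]] := eqVneq (in_nbh e u) set0.
  by right; rewrite /in_deg in0 cards0.
rewrite !inE => ewu eux.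
(* An SODS missing [u] has fewer than [n] vertices, against minimality. *)
have := min_gamma _ (sods_setC1 _ _ _ _ _ e_irr ewu eux).
rewrite gamma_n -order_n leqNgt -cardsT proper_card // properT.
by apply/eqP => /setP/(_ u); rewrite !inE eqxx.
Qed.
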